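(* (i) There exist a compact connected metric space $X$ and a continuous map $f:X\to X$ such that $$h(C(f))<h(C_n(f))<h(C_{n+1}(f))<h(2^f)\quad\text{for all } n\ge 2.$$ (ii) There exist a compact connected metric space $X$ and a continuous map $f:X\to X$ such that $$h_{\mathrm{pol}}(C(f))<h_{\mathrm{pol}}(C_n(f))<h_{\mathrm{pol}}(C_{n+1}(f))<h_{\mathrm{pol}}(2^f)\quad\text{for all } n\ge 2.$$
   Context: For a compact metric space $(X,d)$, $2^X$ is the set of all nonempty closed subsets of $X$ with the Hausdorff metric. $C(X)\subset 2^X$ is the subspace of connected elements of $2^X$, and $C_n(X)\subset 2^X$ is the subspace of those $K\in2^X$ having at most $n$ connected components. A continuous $f:X\to X$ induces $2^f:2^X\to2^X$, $2^f(A)=\{f(x):x\in A\}$, and its restrictions $C(f)=2^f|_{C(X)}:C(X)\to C(X)$ and $C_n(f)=2^f|_{C_n(X)}:C_n(X)\to C_n(X)$. Entropies: for a continuous map $g$ of a compact metric space $(Z,\rho)$ put $\rho_n^g(x,y)=\max_{0\le j\le n-1}\rho(g^j(x),g^j(y))$; a finite set $E$ is $(n,\varepsilon)$-separated if $\rho_n^g(x,y)\ge\varepsilon$ for all distinct $x,y\in E$; $\mathrm{sep}(n,\varepsilon)$ is the maximal cardinality of an $(n,\varepsilon)$-separated subset of $Z$. The topological and polynomial entropies, with values in $[0,\infty]$, are $$h(g)=\lim_{\varepsilon\to0}\limsup_{n\to\infty}\frac{\log\mathrm{sep}(n,\varepsilon)}{n},\qquad h_{\mathrm{pol}}(g)=\lim_{\varepsilon\to0}\limsup_{n\to\infty}\frac{\log\mathrm{sep}(n,\varepsilon)}{\log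 n}.$$ *)

(* Defs.v *)
From HB Require Import structures.
From mathcomp Require Import all_boot all_order all_algebra finmap.
From mathcomp Require Import all_classical all_reals all_analysis.

Set Implicit Arguments.
Unset Strict Implicit.
Unset Printing Implicit Defensive.

Import Order.TTheory GRing.Theory Num.Theory.
Import numFieldNormedType.Exports.

Local Open Scope classical_set_scope.
Local Open Scope ring_scope.

HB.mixin Record isCompactSpace T & Topological T := {
  compact_space : compact [set: T]
}.

#[short(type="compactMetricType")]
HB.structure Definition CompactMetric (R : numDomainType) :=
  { T of Metric R T & isCompactSpace T }.

(* The library equips set_type with the induced pseudometric only. *)
Section set_type_metric.
Context {R : realType} {Z : metricType R} (S : set Z).

Definition set_type_dist (x y : S) : R := mdist (set_val x) (set_val y).

Let set_type_dist_ge0 x y : 0 <= set_type_dist x y.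
Proof. exact: mdist_ge0. Qed.

Let set_type_dist_positivity x y : set_type_dist x y = 0 -> x = y.
Proof. by move=> /mdist_positivity/val_inj. Qed.

Let set_type_ballE (x : S) (d : R) : ball x d = [set y | set_type_dist x y < d].
Proof.
by apply/seteqP; split => y; rewrite -initial_ballE/= ballEmdist.
Qed.

HB.instance Definition _ := @PseudoMetric_isMetric.Build R S
  set_type_dist set_type_dist_ge0 set_type_dist_positivity set_type_ballE.

End set_type_metric.

Section restriction.
Context {T : Type} (S : set T) (g : T -> T) (gS : {homo g : x / S x >-> S x}).

Definition restriction (x : S) : S :=
  exist _ (g (set_val x)) (mem_set (gS (set_mem (valP x)))).

End restriction.

Section hausdorff_dist.
Context {R : realType} {X : metricType R}.
Implicit Types A B : set X.

(* sup and inf are junk outside their domain: these formulas are meant for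
   nonempty bounded sets. *)
Definition dist_to_set (x : X) B : R := inf [set mdist x b | b in B].

Definition hausdorff_dist A B : R :=
  Num.max (sup [set dist_to_set a B | a in A])
          (sup [set dist_to_set b A | b in B]).

End hausdorff_dist.

Section hausdorff_dist_theory.
Context {R : realType} {X : compactMetricType R}.
Implicit Types A B C : set X.

Lemma mdist_continuous (x : X) : continuous (mdist x : X -> R).
Proof.
move=> y; apply/cvgrPdist_lt => e e0; near=> z.
have yz : mdist y z < e.
  near: z; have := nbhsx_ballx y e e0; rewrite ballEmdist; exact.
rewrite (le_lt_trans _ yz)// ler_norml; apply/andP; split.
  by rewrite lerBrDl lerBlDl addrC metric_triangle.
by rewrite lerBlDl (metric_sym y z) metric_triangle.
Unshelve. all: by end_near. Qed.

Lemma mdist_bounded : exists M : R, forall x y : X, mdist x y <= M.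
Proof.
have [[x0]|X0] := pselect (exists x : X, True); last first.
  by exists 0 => x; exfalso; apply: X0; exists x.
have cf : {within [set: X], continuous (mdist x0 : X -> R)}.
  by apply: continuous_subspaceT => ?; exact: mdist_continuous.
have [x1 _ x1max] := compact_EVT_max (ex_intro _ x0 I) compact_space cf.
exists (mdist x0 x1 + mdist x0 x1) => x y.
rewrite (le_trans (metric_triangle x x0 y))// (metric_sym x).
by rewrite lerD// x1max// inE.
Qed.

Lemma dist_to_set_has_inf x B : B !=set0 -> has_inf [set mdist x b | b in B].
Proof.
move=> [b Bb]; split; first by exists (mdist x b), b.
by exists 0 => _ [c _ <-]; exact: mdist_ge0.
Qed.

Lemma dist_to_set_le x B b : B b -> dist_to_set x B <= mdist x b.
Proof.
move=> Bb; apply: ge_inf; last by exists b.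
by have [] := @dist_to_set_has_inf x B (ex_intro _ b Bb).
Qed.

Lemma dist_to_set_ge0 x B : B !=set0 -> 0 <= dist_to_set x B.
Proof.
move=> [b Bb]; apply: lb_le_inf; first by exists (mdist x b), b.
by move=> _ [c _ <-]; exact: mdist_ge0.
Qed.

Lemma dist_to_set_adherent x B e : B !=set0 -> 0 < e ->
  exists2 b, B b & mdist x b < dist_to_set x B + e.
Proof.
move=> B0 e0.
have [_ [b Bb <-] ltb] := inf_adherent e0 (dist_to_set_has_inf x B0).
by exists b.
Qed.

Lemma dist_to_set_has_sup A B : A !=set0 -> B !=set0 ->
  has_sup [set dist_to_set a B | a in A].
Proof.
move=> [a Aa] [b Bb]; split; first by exists (dist_to_set a B), a.
have [M dM] := mdist_bounded; exists M => _ [c _ <-].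
exact: le_trans (dist_to_set_le c Bb) (dM c b).
Qed.

Lemma hausdorff_dist_sym A B : hausdorff_dist A B = hausdorff_dist B A.
Proof. exact: maxC. Qed.

Lemma dist_to_set_le_hausdorff A B a : A a -> B !=set0 ->
  dist_to_set a B <= hausdorff_dist A B.
Proof.
move=> Aa B0; rewrite le_max; apply/orP; left.
have A0 : A !=set0 by exists a.
by have [_ ub] := dist_to_set_has_sup A0 B0; apply: ub_le_sup => //; exists a.
Qed.

Lemma hausdorff_dist_le A B (c : R) : A !=set0 -> B !=set0 ->
  (forall a, A a -> dist_to_set a B <= c) ->
  (forall b, B b -> dist_to_set b A <= c) -> hausdorff_dist A B <= c.
Proof.
move=> [a Aa] [b Bb] AB BA; rewrite ge_max; apply/andP; split.
  by apply: ge_sup; [exists (dist_to_set a B), a|move=> _ [x Ax <-]; exact: AB].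
by apply: ge_sup; [exists (dist_to_set b A), b|move=> _ [x Bx <-]; exact: BA].
Qed.

Lemma hausdorff_dist_ge0 A B : A !=set0 -> B !=set0 -> 0 <= hausdorff_dist A B.
Proof.
move=> [a Aa] B0.
exact: le_trans (dist_to_set_ge0 a B0) (dist_to_set_le_hausdorff Aa B0).
Qed.

Lemma hausdorff_distxx A : A !=set0 -> hausdorff_dist A A = 0.
Proof.
move=> A0; apply/eqP; rewrite eq_le hausdorff_dist_ge0// andbT.
by apply: hausdorff_dist_le => // a Aa;
  rewrite (le_trans (dist_to_set_le a Aa))// mdistxx.
Qed.

Lemma hausdorff_dist0_sub A B : A !=set0 -> B !=set0 -> closed B ->
  hausdorff_dist A B = 0 -> A `<=` B.
Proof.
move=> A0 B0 cB AB0 a Aa; apply: cB => U.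
rewrite -(metricType_numDomainType.filter_from_mdist_nbhs a) => -[e /= e0 aU].
have [b Bb ab] := dist_to_set_adherent a B0 e0.
exists b; split => //; apply: aU => /=; rewrite (lt_le_trans ab)// gerDr.
by rewrite -AB0 dist_to_set_le_hausdorff.
Qed.

Let triangle A B C a : A a -> B !=set0 -> C !=set0 ->
  dist_to_set a C <= hausdorff_dist A B + hausdorff_dist B C.
Proof.
move=> Aa B0 C0; apply/ler_addgt0Pl => e e0.
have e20 : 0 < e / 2 by rewrite divr_gt0.
have [b Bb ab] := dist_to_set_adherent a B0 e20.
have [c Cc bc] := dist_to_set_adherent b C0 e20.
rewrite (le_trans (dist_to_set_le a Cc))// (le_trans (metric_triangle a b c))//.
rewrite (le_trans (ltW (ltrD ab bc)))// addrACA -splitr addrC lerD2l.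
by rewrite lerD// dist_to_set_le_hausdorff.
Qed.

Lemma hausdorff_dist_triangle B A C : A !=set0 -> B !=set0 -> C !=set0 ->
  hausdorff_dist A C <= hausdorff_dist A B + hausdorff_dist B C.
Proof.
move=> A0 B0 C0; apply: hausdorff_dist_le => // [a Aa|c Cc]; first exact: triangle.
rewrite addrC (hausdorff_dist_sym A) (hausdorff_dist_sym B C).
exact: triangle.
Qed.

End hausdorff_dist_theory.

Record hyperspace (R : realType) (X : compactMetricType R) := Hyperspace {
  hset :> set X ;
  hset_neq0 : hset !=set0 ;
  hset_closed : closed hset
}.

Section hyperspace_metric.
Context {R : realType} {X : compactMetricType R}.
Local Notation K := (hyperspace X).

Lemma hset_inj : injective (@hset R X).
Proof.
move=> [A A0 cA] [B B0 cB] /= AB; move: A0 cA; rewrite AB => A0 cA.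
by congr Hyperspace; exact: Prop_irrelevance.
Qed.

HB.instance Definition _ := gen_eqMixin K.
HB.instance Definition _ := gen_choiceMixin K.

Let hdist (A B : K) : R := hausdorff_dist A B.

Let hdistxx A : hdist A A = 0.
Proof. exact/hausdorff_distxx/hset_neq0. Qed.

Let hdist_positivity A B : hdist A B = 0 -> A = B.
Proof.
move=> AB; apply: hset_inj; apply/seteqP; split.
  by apply: hausdorff_dist0_sub AB;
    [exact: hset_neq0|exact: hset_neq0|exact: hset_closed].
by rewrite /hdist hausdorff_dist_sym in AB; apply: hausdorff_dist0_sub AB;
  [exact: hset_neq0|exact: hset_neq0|exact: hset_closed].
Qed.

Let hdist_sym A B : hdist A B = hdist B A.
Proof. exact: hausdorff_dist_sym. Qed.

Let hdist_triangle B A C : hdist A C <= hdist A B + hdist B C.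
Proof. by apply: hausdorff_dist_triangle; exact: hset_neq0. Qed.

HB.instance Definition _ := @isMetric.Build R K
  hdist hdistxx hdist_positivity hdist_sym hdist_triangle.

Lemma hyperspace_mdistE (A B : K) : mdist A B = hausdorff_dist A B.
Proof. by []. Qed.

End hyperspace_metric.

Section hyperspaces.
Context {R : realType} (X : compactMetricType R).

Definition components (A : set X) : set (set X) :=
  [set connected_component A x | x in A].

Definition conn_hyperspace : set (hyperspace X) :=
  [set A : hyperspace X | connected A].

Definition ncomp_hyperspace (n : nat) : set (hyperspace X) :=
  [set A : hyperspace X | (components A #<= `I_n)%card].

End hyperspaces.
Arguments conn_hyperspace {R} X.
Arguments ncomp_hyperspace {R} X n.

Section induced_maps.
Context {R : realType} {X : compactMetricType R} (f : continuousType X X).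

Let fE (A : set X) : {within A, continuous f}.
Proof. by apply: continuous_subspaceT => x; exact: cts_fun. Qed.

Lemma hyper_image_neq0 (A : hyperspace X) : f @` A !=set0.
Proof. by have [a Aa] := hset_neq0 A; exists (f a), a. Qed.

Lemma hyper_image_closed (A : hyperspace X) : closed (f @` A).
Proof.
apply: compact_closed; first exact: metric_hausdorff.
apply: continuous_compact; first exact: fE.
exact: subclosed_compact (@hset_closed _ _ A) compact_space _.
Qed.

Definition hyper_map (A : hyperspace X) : hyperspace X :=
  Hyperspace (@hyper_image_neq0 A) (@hyper_image_closed A).

Lemma hyper_map_conn :
  {homo hyper_map : A / conn_hyperspace X A >-> conn_hyperspace X A}.
Proof. by move=> A cA; apply: connected_continuous_connected => //; exact: fE. Qed.

Lemma hyper_map_ncomp n :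
  {homo hyper_map : A / ncomp_hyperspace X n A >-> ncomp_hyperspace X n A}.
Proof.
move=> A An; apply: (card_le_trans _ An) => {An}.
pose F (K : set X) := \bigcup_(x in K) connected_component (f @` A) (f x).
have -> : components (hyper_map A) = F @` components A; last first.
  by rewrite (card_image_le F (components A)).
rewrite /components /= !image_comp; apply: eq_imagel => x Ax /=.
apply/seteqP; split => [y fy|y [z zx]].
  by exists x => //; apply: connected_component_refl.
suff : connected_component (f @` A) (f x) (f z).
  by move=> xz; rewrite (same_connected_component xz).
exists (f @` connected_component A x); last by exists z.
split; first by exists x => //; exact: connected_component_refl.
- by apply: image_subset; exact: connected_component_sub.
- apply: connected_continuous_connected; first exact: component_connected.
  exact: fE.
Qed.

Definition conn_map : conn_hyperspace X -> conn_hyperspace X :=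
  restriction hyper_map_conn.

Definition ncomp_map (n : nat) : ncomp_hyperspace X n -> ncomp_hyperspace X n :=
  restriction (@hyper_map_ncomp n).

End induced_maps.
Arguments ncomp_map {R X} f n _.

Section entropy.
Context {R : realType} {Z : metricType R} (g : Z -> Z).
Local Open Scope ereal_scope.

Definition dynamic_dist (n : nat) (x y : Z) : R :=
  \big[Num.max/0%R]_(j < n) mdist (iter j g x) (iter j g y).

Definition separated_set (n : nat) (e : R) (E : {fset Z}) : Prop :=
  forall x y, x \in E -> y \in E -> x != y -> (e <= dynamic_dist n x y)%R.

(* When Z is compact and g continuous, this supremum is a maximum. *)
Definition sep (n : nat) (e : R) : \bar R :=
  ereal_sup [set (#|` E|%fset%:R)%:E | E in separated_set n e].

Definition top_entropy : \bar R :=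
  lim (limn_esup (fun n => lne (sep n e) / n%:R%:E) @[e --> (0:R)^'+]).

(* ln n vanishes for n = 0 and n = 1, two terms that the limsup discards. *)
Definition pol_entropy : \bar R :=
  lim (limn_esup (fun n => lne (sep n e) / (ln n%:R)%:E) @[e --> (0:R)^'+]).

End entropy.

(* Main.v *)
From HB Require Import structures.
Require Import Defs.
From mathcomp Require Import all_boot all_order all_algebra finmap.
From mathcomp Require Import all_classical all_reals all_analysis.
From mathcomp Require Import lra ring zify.

(** Both examples live on the unit interval, where a connected closed set is
determined by its two end points. An element of C_k(X) is a union of k
connected closed sets, so a count N of connected sets up to dynamical
indistinguishability gives at most N^k separated elements of C_k(X)
([sep_ncomp_le]). Hence the entropy of C_k(f) is at most k times a bound for
C(f), and it remains to see that this linear growth in k is attained. It then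
increases strictly with k, and the entropy of 2^f, being at least that of every
C_k(f), stays strictly above all of them ([entropy_chain_lt]).

Topological entropy: f is the tent map. An interval of length
about 2^-k contains a dyadic lap of level about k, so its image at that time is
the whole space ([tent_covers]) and only its first k images matter. Up to a given
precision these are known from k binary digits of its left end and a bounded
amount of further data; summing over k up to n there are only O(2^n) classes,
although an interval has two ends. Thus h(C_k(f)) is at most
k log 2 ([top_entropy_tent_le]). For the lower bound one uses sets of k+1 points.
Two such sets must be told apart at one single time, whichever way their points
are matched. So each point gets its own alphabet of laps of f^N: with M
letters for each point this produces entropy (k+1) log M / N
([top_entropy_tent_ge]), and letting N grow with 2^N / M fixed this exceeds
k log 2 ([top_entropy_tent_lt]).

Polynomial entropy: f(x) = min(1, 2x), a monotone map all of whose nonzero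
points reach 1 in finite time. By monotonicity the n-step behaviour of a point, up to a
given precision, takes only O(n) values, so that of an interval takes O(n^2) and
the polynomial entropy of C_k(f) is at most 2k ([pol_entropy_double_cap_le]).
Conversely the 2k ends of k disjoint intervals can be placed independently at
points 2^-t with t of order n. The iterate f^t then sees whether the fundamental
domain between 2^-(t+1) and 2^-t belongs to the set, so that about n^(2k) such
sets are separated ([pol_entropy_double_cap_ge]). *)

Set Implicit Arguments.
Unset Strict Implicit.
Unset Printing Implicit Defensive.

Import Order.TTheory GRing.Theory Num.Theory.
Import numFieldNormedType.Exports.

Local Open Scope classical_set_scope.
Local Open Scope ring_scope.

(** * Counting separated sets *)

Section separated_sets.
Context {R : realType} {Z : metricType R} (g : Z -> Z).
Implicit Types (n : nat) (e : R).

Lemma dynamic_dist_lt n e x y : 0 < e ->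
  (forall j, (j < n)%N -> mdist (iter j g x) (iter j g y) < e) ->
  dynamic_dist g n x y < e.
Proof. by move=> e0 xye; apply: bigmax_lt => // j _; exact: xye. Qed.

Lemma dynamic_dist_ge n e x y j : (j < n)%N ->
  e <= mdist (iter j g x) (iter j g y) -> e <= dynamic_dist g n x y.
Proof. by move=> jn /le_trans; apply; exact: (le_bigmax _ _ (Ordinal jn)). Qed.

Lemma dynamic_dist_sym n x y : dynamic_dist g n x y = dynamic_dist g n y x.
Proof. by apply: eq_bigr => j _; rewrite metric_sym. Qed.

Lemma dynamic_distxx n x : dynamic_dist g n x x = 0.
Proof.
by rewrite /dynamic_dist; elim/big_rec: _ => // j d _ ->; rewrite mdistxx maxxx.
Qed.

(** Pigeonhole: the classes of [cl] have dynamic diameter below [e], so a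
separated set meets each of them at most once. *)
Lemma sep_le_card (F : finType) (cl : Z -> F) n e :
  (forall x y, cl x = cl y -> dynamic_dist g n x y < e) ->
  (sep g n e <= #|F|%:R%:E)%E.
Proof.
move=> cle; apply: ge_ereal_sup => _ [E sepE <-]; rewrite lee_fin ler_nat.
rewrite cardfE -(@card_in_imset _ _ (fun x : E => cl (val x)) E); last first.
  move=> x y _ _ /cle; rewrite ltNge => xy; apply/eqP; apply: contraNT xy => xy.
  by apply: sepE => //; exact: valP.
exact: max_card.
Qed.

Lemma sep_ge_card (I : finType) (phi : I -> Z) n e : 0 < e ->
  (forall i k, i != k -> e <= dynamic_dist g n (phi i) (phi k)) ->
  (#|I|%:R%:E <= sep g n e)%E.
Proof.
move=> e0 phie; have phi_inj : injective phi.
  move=> i k ik; apply/eqP/negPn/negP => /phie.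
  by rewrite ik dynamic_distxx leNgt e0.
apply: ereal_sup_ubound; exists [fset phi i | i in I]%fset => /=.
  move=> _ _ /imfsetP[i _ ->] /imfsetP[k _ ->] ik; apply: phie.
  by apply: contra_neq ik => ->.
by rewrite card_imfset//= -cardE.
Qed.

Lemma sep_monotone n e d : d <= e -> (sep g n e <= sep g n d)%E.
Proof.
move=> de; apply: ereal_sup_le => _ [E sepE <-]; exists E => //.
by move=> x y xE yE xy; rewrite (le_trans de)//; exact: sepE.
Qed.

End separated_sets.

(** The image of a separated set under an equivariant isometric embedding is
separated. *)
Lemma sep_embedding (R : realType) (Y Z : metricType R) (g : Y -> Y)
    (h : Z -> Z) (phi : Y -> Z) n (e : R) :
  (forall x y, mdist (phi x) (phi y) = mdist x y) ->
  (forall x, phi (g x) = h (phi x)) -> (sep g n e <= sep h n e)%E.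
Proof.
move=> iso phig; have phi_inj : injective phi.
  by move=> x y xy; apply: mdist_positivity; rewrite -iso xy mdistxx.
have iterE j x : iter j h (phi x) = phi (iter j g x).
  by elim: j => //= j ->; rewrite phig.
apply: ereal_sup_le => _ [E sepE <-]; exists [fset phi x | x in E]%fset.
  move=> _ _ /imfsetP[x xE ->] /imfsetP[y yE ->] xy.
  rewrite /dynamic_dist; under eq_bigr do rewrite !iterE iso.
  by apply: sepE => //; apply: contra_neq xy => ->.
by rewrite card_imfset.
Qed.

Section entropy_at_rate.
Context {R : realType}.

(** The topological entropy is the case [r n = n], the polynomial entropy the
case [r n = ln n], both by definition. *)
Definition entropy_at_rate (r : nat -> R) (Z : metricType R) (g : Z -> Z) :=
  lim (limn_esup (fun n => lne (sep g n e) / (r n)%:E)%E @[e --> (0:R)^'+]).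

Variable r : nat -> R.
Hypothesis r_ge0 : forall n, 0 <= r n.

Lemma sep_ge0 (Z : metricType R) (g : Z -> Z) n e : (0 <= sep g n e)%E.
Proof. by apply: ereal_sup_ubound; exists fset0 => //; rewrite cardfs0. Qed.

Lemma growth_le (s t : nat -> \bar R) :
  (forall n, 0 <= s n)%E -> (forall n, s n <= t n)%E ->
  (limn_esup (fun n => lne (s n) / (r n)%:E) <=
   limn_esup (fun n => lne (t n) / (r n)%:E))%E.
Proof.
move=> s0 st; apply: le_ereal_inf_tmp => _ [V ooV <-].
apply: (@le_trans _ _ (ereal_sup ((fun n => lne (s n) / (r n)%:E)%E @` V))).
  by apply: ereal_inf_lbound; exists V.
apply: ge_ereal_sup => _ [n Vn <-].
apply: (@le_trans _ _ (lne (t n) / (r n)%:E)%E); last first.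
  by apply: ereal_sup_ubound; exists n.
apply: lee_wpmul2r; first by rewrite inve_ge0 lee_fin.
by rewrite lee_lne// in_itv/= ?leey ?andbT// (le_trans (s0 n)).
Qed.

(** The growth rate of the number of separated points is nonincreasing in the
precision [e], so its limit at 0 is a supremum. An upper bound must therefore be
checked at every precision, a lower bound at a single one. *)
Lemma entropy_at_rateE (Z : metricType R) (g : Z -> Z) :
  entropy_at_rate r g =
  ereal_sup [set limn_esup (fun n => lne (sep g n e) / (r n)%:E)%E |
    e in [set e : R | 0 < e]].
Proof.
have := @nonincreasing_at_right_cvge R
  (fun e => limn_esup (fun n => lne (sep g n e) / (r n)%:E)%E) 0 (BInfty R false).
move=> /(_ isT) H; rewrite /entropy_at_rate; apply/cvg_lim => //.
have -> : [set e : R | 0 < e] = [set` Interval (BRight (0:R)) (BInfty R false)].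
  by apply/seteqP; split => x /=; rewrite in_itv/= andbT.
apply: H => x y _ _ xy; apply: growth_le => n; first exact: sep_ge0.
exact: sep_monotone.
Qed.

Lemma entropy_at_rate_embedding (Y Z : metricType R) (g : Y -> Y) (h : Z -> Z)
    (phi : Y -> Z) :
  (forall x y, mdist (phi x) (phi y) = mdist x y) ->
  (forall x, phi (g x) = h (phi x)) ->
  (entropy_at_rate r g <= entropy_at_rate r h)%E.
Proof.
move=> iso phig; rewrite !entropy_at_rateE; apply: ge_ereal_sup => _ [e e0 <-].
apply: le_ereal_sup_tmp; eexists; first by exists e.
by apply: growth_le => n; [exact: sep_ge0|exact: sep_embedding phig].
Qed.

Lemma lne_sep_le (Z : metricType R) (g : Z -> Z) n e (P : nat) : (0 < P)%N ->
  (sep g n e <= P%:R%:E)%E -> (lne (sep g n e) <= (ln P%:R)%:E)%E.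
Proof.
move=> P0 sepP; have P0R : 0 < P%:R :> R by rewrite ltr0n.
by rewrite -lne_EFin// lee_lne// in_itv/= leey ?sep_ge0// lee_fin ltW.
Qed.

Lemma lne_sep_ge (Z : metricType R) (g : Z -> Z) n e (P : nat) : (0 < P)%N ->
  (P%:R%:E <= sep g n e)%E -> ((ln P%:R)%:E <= lne (sep g n e))%E.
Proof.
move=> P0 sepP; have P0R : 0 < P%:R :> R by rewrite ltr0n.
by rewrite -lne_EFin// lee_lne// in_itv/= leey ?sep_ge0// lee_fin ltW.
Qed.

Hypothesis r_cvgy : r n @[n --> \oo] --> +oo.

Let rate_eventually (c d : R) : 0 < d ->
  exists N, forall n, (N <= n)%N -> 0 < r n /\ c <= d * r n.
Proof.
move=> d0; have /cvgryPge/(_ (Num.max 1 (c / d))) := r_cvgy.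
move=> -[N _ NV]; exists N => n /NV /=; rewrite ge_max => /andP[r1 rc].
by split; [exact: lt_le_trans r1|rewrite mulrC -ler_pdivrMr].
Qed.

(** The additive constant [c], which may depend on the precision, disappears
after division by [r n]. *)
Lemma entropy_at_rate_le (Z : metricType R) (g : Z -> Z) (L : R) :
  (forall e, 0 < e -> exists c, forall n, (0 < n)%N ->
     (lne (sep g n e) <= (L * r n + c)%:E)%E) ->
  (entropy_at_rate r g <= L%:E)%E.
Proof.
move=> sepL; rewrite entropy_at_rateE; apply: ge_ereal_sup => _ [e e0 <-].
have {sepL e0} [c sepc] := sepL e e0.
apply/lee_addgt0Pr => d d0; have [N rN] := rate_eventually c d0.
apply: ereal_inf_le; eexists; first by exists [set n | (N.+1 <= n)%N] => //; exists N.+1.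
apply: ge_ereal_sup => _ [n /= Nn <-]; have [r0 rc] := rN n (ltnW Nn).
rewrite inver gt_eqF// lee_pdivrMr// (le_trans (sepc _ _))//.
  exact: leq_ltn_trans Nn.
by rewrite lee_fin mulrDl lerD2l.
Qed.

(** As a limsup is taken, it is enough to count separated points along an
unbounded sequence [u] of times. *)
Lemma entropy_at_rate_ge (Z : metricType R) (g : Z -> Z) (L c e : R)
    (u : nat -> nat) : 0 < e -> (forall l, (l <= u l)%N) ->
  (forall l, (0 < l)%N -> ((L * r (u l) - c)%:E <= lne (sep g (u l) e))%E) ->
  (L%:E <= entropy_at_rate r g)%E.
Proof.
move=> e0 lu sepL; rewrite entropy_at_rateE.
apply: le_ereal_sup_tmp; eexists; first by exists e.
apply: le_ereal_inf_tmp => _ [V [M _ MV] <-].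
apply/lee_subgt0Pr => d d0; have [N rN] := rate_eventually c d0.
pose l := (maxn M N).+1.
have Ml : (M <= u l)%N by rewrite (leq_trans _ (lu l))// leqW// leq_maxl.
have Nl : (N <= u l)%N by rewrite (leq_trans _ (lu l))// leqW// leq_maxr.
apply: le_ereal_sup_tmp; eexists; first by exists (u l) => //; exact: MV.
have [r0 rc] := rN _ Nl.
rewrite inver gt_eqF// lee_pdivlMr// (le_trans _ (sepL l _))//.
by rewrite -EFinB -EFinM lee_fin mulrBl lerB.
Qed.

End entropy_at_rate.

(** * Dynamics on hyperspaces *)

Section restricted_map.
Context {R : realType} {Z : metricType R} (S : set Z) (g : Z -> Z).
Hypothesis gS : {homo g : x / S x >-> S x}.

Lemma iter_restriction j (x : S) :
  set_val (iter j (restriction gS) x) = iter j g (set_val x).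
Proof. by elim: j => //= j <-. Qed.

Lemma dynamic_dist_restriction n (x y : S) :
  dynamic_dist (restriction gS) n x y = dynamic_dist g n (set_val x) (set_val y).
Proof. by apply: eq_bigr => j _; rewrite -!iter_restriction. Qed.

End restricted_map.

Section hyperspace_dynamics.
Context {R : realType} {X : compactMetricType R} (f : continuousType X X).
Implicit Types (A B : hyperspace X) (e : R).

Lemma iter_hyper_map j A : hset (iter j (hyper_map f) A) = iter j f @` A.
Proof.
elim: j => [|j IHj]; first by rewrite -[LHS]image_id.
by rewrite iterS /= IHj image_comp.
Qed.

Lemma dynamic_dist_hyper_lt n A B d e : 0 < e -> d < e ->
  (forall j, (j < n)%N -> forall a, hset A a ->
     exists2 b, hset B b & mdist (iter j f a) (iter j f b) <= d) ->
  (forall j, (j < n)%N -> forall b, hset B b ->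
     exists2 a, hset A a & mdist (iter j f b) (iter j f a) <= d) ->
  dynamic_dist (hyper_map f) n A B < e.
Proof.
move=> e0 de AB BA; apply: dynamic_dist_lt => // j jn; apply: le_lt_trans de.
apply: hausdorff_dist_le; [exact: hset_neq0|exact: hset_neq0| |];
  rewrite !iter_hyper_map => _ [x xX <-].
  have [y yY xy] := AB j jn x xX.
  by apply: le_trans xy; apply: dist_to_set_le; exists y.
have [y yY xy] := BA j jn x xX.
by apply: le_trans xy; apply: dist_to_set_le; exists y.
Qed.

Lemma dynamic_dist_hyper_ge n A B e j a : (j < n)%N -> hset A a ->
  (forall b, hset B b -> e <= mdist (iter j f a) (iter j f b)) ->
  e <= dynamic_dist (hyper_map f) n A B.
Proof.
move=> jn Aa aB; apply: (dynamic_dist_ge jn); rewrite hyperspace_mdistE.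
apply: (@le_trans _ _ (dist_to_set (iter j f a) (iter j (hyper_map f) B))).
  rewrite iter_hyper_map; have [b Bb] := hset_neq0 B.
  apply: lb_le_inf; first by exists (mdist (iter j f a) (iter j f b)), (iter j f b).
  by move=> _ [_ [y By <-] <-]; exact: aB.
apply: dist_to_set_le_hausdorff; last exact: hset_neq0.
by rewrite iter_hyper_map; exists a.
Qed.

End hyperspace_dynamics.

Section finitely_many_components.
Context {R : realType} {X : compactMetricType R}.

(** Each nonempty piece [C i] lies in a single component, and every component
contains a piece, so the pieces enumerate the components. *)
Lemma ncomp_bigcup n (A : hyperspace X) (C : 'I_n -> set X) :
  (forall i, connected (C i)) -> hset A = \bigcup_i C i -> ncomp_hyperspace X n A.
Proof.
move=> Cc AC; have [x0 _] := hset_neq0 A; apply/pcard_surjP.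
pose g k := if insub k is Some i then
  connected_component A (xget x0 (C i)) else set0.
(* [xget] selects a point of the nonempty piece that contains [x]; the
   component of that point is also the one of [x]. *)
exists g => _ [x Ax <-].
have [i _ Cix] : (\bigcup_i C i) x by rewrite -AC.
exists (i : nat); first exact: ltn_ord.
rewrite /g valK; apply: esym; apply: same_connected_component.
exists (C i); last exact: (xgetI x0 Cix).
by split => //; rewrite AC => y Ciy; exists i.
Qed.

(** Exactly [n] pieces are provided, possibly with repetitions, so that families
of pieces are indexed by ['I_n] whatever the number of components. *)
Lemma ncomp_decomposition n (A : hyperspace X) : ncomp_hyperspace X n A ->
  exists C : 'I_n -> hyperspace X,
    (forall i, connected (C i)) /\ hset A = \bigcup_i C i.
Proof.
move=> /pcard_surjP[g surj_g]; have [x0 Ax0] := hset_neq0 A.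
pose P k := [set x | hset A x /\ connected_component A x = g k].
pose p k := xget x0 (P k).
have Ap k : hset A (p k) by rewrite /p; case: xgetP => [x _ []|].
pose C (i : 'I_n) := Hyperspace
  (ex_intro _ (p i) (connected_component_refl (Ap i)) :
    connected_component A (p i) !=set0)
  (@component_closed _ _ (p i) (@hset_closed _ _ A)).
exists C; split=> [i|]; first exact: component_connected.
apply/seteqP; split => [x Ax|x [i _] /connected_component_sub//].
have [k kn gk] := surj_g _ (ex_intro2 _ _ x Ax erefl).
have [_ pk] : P k (p k) by apply: (@xgetI _ x0 _ x).
exists (Ordinal kn) => //; change (connected_component A (p k) x).
by rewrite pk gk; exact: connected_component_refl.
Qed.

End finitely_many_components.

Section entropy_of_ncomp_map.
Context {R : realType} {X : compactMetricType R} (f : continuousType X X).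

(** A class of elements of C_k(X) is the k-tuple of the classes of the pieces:
if the pieces are pairwise close along an orbit segment, so are the unions.
The closeness hypothesis is one-sided because it is applied to both (A, B) and
(B, A). *)
Lemma sep_ncomp_le (F : finType) (cl : hyperspace X -> F) k n (d e : R) :
  0 < e -> d < e ->
  (forall A B : hyperspace X, connected A -> connected B -> cl A = cl B ->
     forall j, (j < n)%N -> forall a, hset A a ->
     exists2 b, hset B b & mdist (iter j f a) (iter j f b) <= d) ->
  (sep (ncomp_map f k) n e <= (#|F| ^ k)%:R%:E)%E.
Proof.
move=> e0 de clP.
have [C CP] := choice (fun A : ncomp_hyperspace X k =>
  ncomp_decomposition (set_mem (valP A))).
have Cclose (A B : ncomp_hyperspace X k) :
    [ffun i => cl (C A i)] = [ffun i => cl (C B i)] ->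
    forall j, (j < n)%N -> forall a, hset (set_val A) a ->
    exists2 b, hset (set_val B) b & mdist (iter j f a) (iter j f b) <= d.
  move=> /ffunP clAB j jn a; have [[Ac ->] [Bc ->]] := (CP A, CP B).
  move=> [i _ Aia]; have := clAB i; rewrite !ffunE => clABi.
  by have [b Bb ab] := clP _ _ (Ac i) (Bc i) clABi j jn a Aia; exists b => //; exists i.
have -> : (#|F| ^ k)%N = #|{ffun 'I_k -> F}| by rewrite card_ffun card_ord.
apply: (@sep_le_card _ _ _ _ (fun A => [ffun i => cl (C A i)])) => A B AB.
rewrite dynamic_dist_restriction; apply: dynamic_dist_hyper_lt e0 de _ _.
  exact: Cclose.
by move=> j jn b; apply: Cclose.
Qed.

Lemma sep_ncomp_ge (I : finType) (A_ : I -> hyperspace X) k n e : 0 < e ->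
  (forall i, ncomp_hyperspace X k (A_ i)) ->
  (forall i j, i != j -> e <= dynamic_dist (hyper_map f) n (A_ i) (A_ j)) ->
  (#|I|%:R%:E <= sep (ncomp_map f k) n e)%E.
Proof.
move=> e0 Ak Ae.
pose phi i : ncomp_hyperspace X k := exist _ (A_ i) (mem_set (Ak i)).
apply: (@sep_ge_card _ _ _ _ phi) => // i j ij.
by rewrite dynamic_dist_restriction; exact: Ae.
Qed.

Variable r : nat -> R.
Hypothesis r_ge0 : forall n, 0 <= r n.

Lemma entropy_conn_le_ncomp1 :
  (entropy_at_rate r (conn_map f) <= entropy_at_rate r (ncomp_map f 1))%E.
Proof.
have conn_ncomp1 (A : conn_hyperspace X) : ncomp_hyperspace X 1 (set_val A).
  apply: (@ncomp_bigcup _ _ _ _ (fun=> hset (set_val A))).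
    by move=> _; exact: set_mem (valP A).
  by apply/seteqP; split => [x Ax|x []//]; exists ord0.
pose phi (A : conn_hyperspace X) : ncomp_hyperspace X 1 :=
  exist _ (set_val A) (mem_set (conn_ncomp1 A)).
by apply: (@entropy_at_rate_embedding _ _ r_ge0 _ _ _ _ phi) => // A; exact: val_inj.
Qed.

Lemma entropy_ncomp_le_hyper k :
  (entropy_at_rate r (ncomp_map f k) <= entropy_at_rate r (hyper_map f))%E.
Proof. exact: (@entropy_at_rate_embedding _ _ r_ge0 _ _ _ _ set_val). Qed.

(** The entropy of 2^f exceeds that of the map on C_(k+1)(X) because it
dominates the one on C_(k+2)(X), which is strictly larger. *)
Lemma entropy_chain_lt :
  (forall k, (0 < k)%N ->
    (entropy_at_rate r (ncomp_map f k) < entropy_at_rate r (ncomp_map f k.+1))%E) ->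
  forall k, (2 <= k)%N ->
    [/\ (entropy_at_rate r (conn_map f) < entropy_at_rate r (ncomp_map f k))%E,
        (entropy_at_rate r (ncomp_map f k) < entropy_at_rate r (ncomp_map f k.+1))%E &
        (entropy_at_rate r (ncomp_map f k.+1) < entropy_at_rate r (hyper_map f))%E].
Proof.
move=> lt_succ k k2; split.
- apply: le_lt_trans entropy_conn_le_ncomp1 _.
  rewrite -(subnK k2) addn2; elim: (k - 2)%N => [|l IHl]; first exact: lt_succ.
  by apply: lt_trans IHl _; exact: lt_succ.
- by apply: lt_succ; exact: ltnW.
- exact: lt_le_trans (lt_succ k.+1 _) (entropy_ncomp_le_hyper k.+2).
Qed.

End entropy_of_ncomp_map.

(** * The unit interval and its Lipschitz self-maps *)

Lemma lipschitz_continuous (R : realType) (Y Z : metricType R) (h : Y -> Z)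
    (k : R) :
  (forall x y, mdist (h x) (h y) <= k * mdist x y) -> continuous h.
Proof.
move=> hk x U; rewrite -!metricType_numDomainType.filter_from_mdist_nbhs.
move=> -[e /= e0 eU].
have k0 : 0 < `|k| + 1 by rewrite ltr_wpDl.
exists (e / (`|k| + 1)) => /=; first by rewrite divr_gt0.
move=> y /=; rewrite ltr_pdivlMr// => xy; apply: eU => /=.
apply: le_lt_trans xy; rewrite (le_trans (hk x y))// mulrC ler_wpM2l ?mdist_ge0//.
by rewrite (le_trans (ler_norm k))// lerDl.
Qed.

Definition unit_interval (R : realType) : Type :=
  set_type (`[0%R, 1%R]%classic : set R^o).

HB.instance Definition _ (R : realType) := Metric.on (unit_interval R).

Section unit_interval_topology.
Context {R : realType}.
Local Notation X := (unit_interval R).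

Definition ucoord (x : X) : R := set_val x.

Lemma ucoord_ge0 x : 0 <= ucoord x.
Proof. by have := set_mem (valP x); rewrite /= in_itv/= => /andP[]. Qed.

Lemma ucoord_le1 x : ucoord x <= 1.
Proof. by have := set_mem (valP x); rewrite /= in_itv/= => /andP[]. Qed.

Lemma ucoord_inj : injective ucoord.
Proof. exact: val_inj. Qed.

Lemma mdist_ucoord (x y : X) : mdist x y = `|ucoord x - ucoord y|.
Proof. by rewrite distrC. Qed.

Definition clamp (x : R) : R := Num.max 0 (Num.min 1 x).

Let clamp_in01 x : clamp x \in (`[0%R, 1%R]%classic : set R^o).
Proof.
by rewrite inE/= in_itv/= le_max lexx ge_max ge_min lexx ler01.
Qed.

(** A retraction of the line onto the interval: through it, the interval
and its subintervals inherit compactness and connectedness from real segments. *)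
Definition to_unit (x : R) : X := exist _ (clamp x) (clamp_in01 x).

Lemma ucoord_to_unit x : ucoord (to_unit x) = clamp x.
Proof. by []. Qed.

Lemma to_unitK (x : R) : 0 <= x <= 1 -> ucoord (to_unit x) = x.
Proof.
by move=> /andP[x0 x1]; rewrite ucoord_to_unit /clamp min_r// max_r.
Qed.

Lemma ucoordK x : to_unit (ucoord x) = x.
Proof. by apply: ucoord_inj; rewrite to_unitK// ucoord_ge0 ucoord_le1. Qed.

Lemma ucoord_continuous : continuous (ucoord : X -> R^o).
Proof.
apply: (@lipschitz_continuous _ _ _ _ 1) => x y.
by rewrite mul1r mdist_ucoord distrC.
Qed.

Lemma to_unit_continuous : continuous (to_unit : R^o -> X).
Proof.
apply: (@lipschitz_continuous _ _ _ _ 1) => x y.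
rewrite mul1r mdist_ucoord [leRHS]distrC !ucoord_to_unit /clamp.
rewrite /Num.max /Num.min; do ![case: ifPn]; rewrite -?leNgt => *;
  rewrite ler_norml; apply/andP; split;
  have := ler_norm (x - y); have := ler_norm (y - x); rewrite (distrC y x); lra.
Qed.

Lemma to_unit_itv (a b : R) : 0 <= a -> b <= 1 ->
  to_unit @` `[a, b] = [set x | a <= ucoord x <= b].
Proof.
move=> a0 b1; apply/seteqP; split => [_ [x + <-]|x /= axb].
  rewrite /= in_itv/= => /andP[ax xb].
  by rewrite to_unitK ?ax// (le_trans a0 ax) (le_trans xb b1).
by exists (ucoord x); [rewrite /= in_itv|exact: ucoordK].
Qed.

Lemma unit_itv_connected (a b : R) : 0 <= a -> b <= 1 ->
  connected [set x : X | a <= ucoord x <= b].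
Proof.
move=> a0 b1; rewrite -to_unit_itv//; apply: connected_continuous_connected.
  exact: segment_connected.
by apply: continuous_subspaceT => x; exact: to_unit_continuous.
Qed.

Lemma unit_itv_compact (a b : R) : 0 <= a -> b <= 1 ->
  compact [set x : X | a <= ucoord x <= b].
Proof.
move=> a0 b1; rewrite -to_unit_itv//; apply: continuous_compact.
  by apply: continuous_subspaceT => x; exact: to_unit_continuous.
exact: segment_compact.
Qed.

Let setT_itv : [set: X] = [set x | 0 <= ucoord x <= 1].
Proof.
by apply/seteqP; split => // x _ /=; rewrite ucoord_ge0 ucoord_le1.
Qed.

Let unit_interval_compact : compact [set: X].
Proof. by rewrite setT_itv; exact: unit_itv_compact. Qed.

HB.instance Definition _ := isCompactSpace.Build X unit_interval_compact.

Lemma unit_interval_connected : connected [set: X].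
Proof. by rewrite setT_itv; exact: unit_itv_connected. Qed.

Lemma unit_itv_closed (a b : R) : 0 <= a -> b <= 1 ->
  closed [set x : X | a <= ucoord x <= b].
Proof.
move=> a0 b1; apply: compact_closed; first exact: metric_hausdorff.
exact: unit_itv_compact.
Qed.

Lemma connected_ucoordP (A : set X) x y z : connected A -> A x -> A y ->
  ucoord x <= ucoord z <= ucoord y -> A z.
Proof.
move=> Ac Ax Ay xzy.
have /connected_intervalP iA : connected ((ucoord : X -> R^o) @` A).
  apply: connected_continuous_connected => //.
  by apply: continuous_subspaceT => ?; exact: ucoord_continuous.
have [w Aw /ucoord_inj <-//] : ((ucoord : X -> R^o) @` A) (ucoord z).
by apply: iA xzy; [exists x|exists y].
Qed.

Lemma hyperspace_ends : exists ends : hyperspace X -> X * X, forall A,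
  [/\ hset A (ends A).1, hset A (ends A).2 &
    forall z, hset A z -> ucoord (ends A).1 <= ucoord z <= ucoord (ends A).2].
Proof.
suff : forall A : hyperspace X, exists ab : X * X,
    [/\ hset A ab.1, hset A ab.2 &
      forall z, hset A z -> ucoord ab.1 <= ucoord z <= ucoord ab.2].
  by move=> /choice[ends endsP]; exists ends.
move=> A; have cA := subclosed_compact (@hset_closed _ _ A) compact_space (@subsetT _ _).
have cc : {within hset A, continuous (ucoord : X -> R)}.
  by apply: continuous_subspaceT => ?; exact: ucoord_continuous.
have [a + amin] := compact_EVT_min (hset_neq0 A) cA cc; rewrite inE => Aa.
have [b + bmax] := compact_EVT_max (hset_neq0 A) cA cc; rewrite inE => Ab.
by exists (a, b); split => // z Az; rewrite amin ?inE// bmax ?inE.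
Qed.

(** Two intervals [A], [B] with ends (a, b) and (c, d): a point of [A] that is
not in [B] lies between [a] and [c] or between [d] and [b]. Hence only the gaps
between corresponding ends have to be controlled by [h]. *)
Lemma connected_compare (A B : set X) (h : X -> X) (a b c d : X) (e : R) :
  0 <= e -> connected B -> B c -> B d ->
  (forall z, A z -> ucoord a <= ucoord z <= ucoord b) ->
  (forall z, ucoord a <= ucoord z <= ucoord c -> mdist (h z) (h c) <= e) ->
  (forall z, ucoord d <= ucoord z <= ucoord b -> mdist (h z) (h d) <= e) ->
  forall z, A z -> exists2 w, B w & mdist (h z) (h w) <= e.
Proof.
move=> e0 cB Bc Bd Aab ac db z /Aab /andP[az zb].
have [zc|cz] := leP (ucoord z) (ucoord c); first by exists c => //; rewrite ac// az.
have [dz|zd] := leP (ucoord d) (ucoord z); first by exists d => //; rewrite db// dz.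
exists z; last by rewrite mdistxx.
by apply: connected_ucoordP Bc Bd _ => //; rewrite !ltW.
Qed.

Lemma interval_union k (a b : 'I_k.+1 -> R) :
  (forall i, 0 <= a i /\ a i <= b i /\ b i <= 1) ->
  exists2 A : hyperspace X, ncomp_hyperspace X k.+1 A &
    hset A = [set x | exists i, a i <= ucoord x <= b i].
Proof.
move=> ab01; pose C i := [set x : X | a i <= ucoord x <= b i].
have UE : [set x | exists i, a i <= ucoord x <= b i] = \bigcup_i C i.
  by apply/seteqP; split => x [i]; exists i.
have U0 : \bigcup_i C i !=set0.
  have [a0 [ab b1]] := ab01 ord0; exists (to_unit (a ord0)), ord0 => //.
  rewrite /C /mkset to_unitK ?lexx ?ab//.
  by rewrite a0 (le_trans ab).
have cU : closed (\bigcup_i C i).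
  apply: closed_bigcup => [|i _]; first exact: finite_finset.
  by have [a0 [_ b1]] := ab01 i; exact: unit_itv_closed.
exists (Hyperspace U0 cU); last by rewrite UE.
apply: (@ncomp_bigcup _ _ _ _ C) => // i.
by have [a0 [_ b1]] := ab01 i; exact: unit_itv_connected.
Qed.

End unit_interval_topology.

Section interval_map.
Context {R : realType}.
Local Notation X := (unit_interval R).

(** The Lipschitz constant is 2, which is that of the two maps considered below. *)
Record interval_map := IntervalMap {
  imap :> R -> R;
  imap_in01 : forall x, 0 <= x <= 1 -> 0 <= imap x <= 1;
  imap_lip : forall x y, `|imap x - imap y| <= 2 * `|x - y| }.

Variable F : interval_map.

Definition unit_map (x : X) : X := to_unit (F (ucoord x)).

Lemma ucoord_unit_map x : ucoord (unit_map x) = F (ucoord x).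
Proof. by rewrite to_unitK// imap_in01// ucoord_ge0 ucoord_le1. Qed.

Lemma ucoord_iter_unit_map j x : ucoord (iter j unit_map x) = iter j F (ucoord x).
Proof. by elim: j => //= j <-; rewrite ucoord_unit_map. Qed.

Let unit_map_continuous : continuous unit_map.
Proof.
apply: (@lipschitz_continuous _ _ _ _ 2) => x y.
by rewrite !mdist_ucoord !ucoord_unit_map imap_lip.
Qed.

HB.instance Definition _ := isContinuous.Build X X unit_map unit_map_continuous.

Definition unit_cmap : continuousType X X := unit_map.

Lemma iter_imap_lip j x y : `|iter j F x - iter j F y| <= 2 ^+ j * `|x - y|.
Proof.
elim: j => [|j IHj]; first by rewrite expr0 mul1r.
by rewrite !iterS (le_trans (imap_lip _ _ _))// exprS -mulrA ler_pM2l.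
Qed.

End interval_map.

(** * The tent map *)

Section tent.
Context {R : realType}.
Local Notation X := (unit_interval R).

Definition tent (x : R) : R := Num.min (2 * x) (2 - 2 * x).

Lemma tent_in01 x : 0 <= x <= 1 -> 0 <= tent x <= 1.
Proof.
move=> /andP[x0 x1]; rewrite /tent /Num.min; case: ifPn; rewrite -?leNgt => *;
  by apply/andP; split; lra.
Qed.

Lemma tent_lip x y : `|tent x - tent y| <= 2 * `|x - y|.
Proof.
have := ler_norm (x - y); have := ler_norm (y - x); rewrite (distrC y x) /tent.
by rewrite /Num.min; do ![case: ifPn]; rewrite -?leNgt => *;
  rewrite ler_norml; apply/andP; split; lra.
Qed.

Definition tent_map : interval_map := IntervalMap tent_in01 tent_lip.

Definition tent_cmap : continuousType X X := unit_cmap tent_map.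

(** The N-th iterate is affine on each of the 2^N dyadic laps, onto [0, 1],
increasing on even laps and decreasing on odd ones. *)
Lemma iter_tent_lap N s (y : R) : (s < 2 ^ N)%N -> 0 <= y <= 1 ->
  iter N tent ((s%:R + y) / 2 ^+ N) = if odd s then 1 - y else y.
Proof.
elim: N s y => [|N IHN] s y.
  by rewrite expn0 ltnS leqn0 => /eqP -> _; rewrite add0r divr1.
move=> sN /andP[y0 y1]; rewrite iterSr.
have N0 : 0 < 2 ^+ N :> R by rewrite exprn_gt0.
have -> : (s%:R + y) / 2 ^+ N.+1 = (s%:R + y) / 2 ^+ N / 2.
  by rewrite exprS invfM [_^-1 * _]mulrC mulrA.
have [s_lt|s_ge] := ltnP s (2 ^ N).
  have : (s%:R + y) / 2 ^+ N <= 1.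
    rewrite ler_pdivrMr// mul1r -natrX (@le_trans _ _ s.+1%:R) ?ler_nat//.
    by rewrite -natr1 lerD2l.
  rewrite -(IHN _ _ s_lt); last by rewrite y0.
  set t := _ / _ => t1; congr iter.
  by rewrite /tent /Num.min; case: ifPn; rewrite -?leNgt => *; lra.
have : 1 <= (s%:R + y) / 2 ^+ N.
  rewrite ler_pdivlMr// mul1r -natrX (@le_trans _ _ s%:R) ?ler_nat//.
  by rewrite lerDl.
(* The right half is the mirror image of the left one; the mirror exchanges
   the parities of laps, as 2^(N+1) - 1 is odd. *)
set s' := (2 ^ N.+1 - s.+1)%N.
have s'E : s'%:R = 2 * 2 ^+ N - s%:R - 1 :> R.
  by rewrite natrB// natrX exprS -[s.+1%:R]natr1 opprD addrA.
have s'N : (s' < 2 ^ N)%N by rewrite /s' expnS; lia.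
have odds' : odd s' = ~~ odd s.
  by rewrite oddB// oddX.
have : iter N tent ((s'%:R + (1 - y)) / 2 ^+ N) = if odd s' then 1 - (1 - y) else 1 - y.
  by apply: IHN => //; apply/andP; split; lra.
rewrite odds' if_neg subKr => <-.
have -> : (s'%:R + (1 - y)) / 2 ^+ N = 2 - (s%:R + y) / 2 ^+ N.
  by rewrite s'E; field; rewrite gt_eqF.
set t := _ / 2 ^+ N => t1; congr iter.
by rewrite /tent /Num.min; case: ifPn; rewrite -?leNgt => *; lra.
Qed.

(** An interval of length at least 2 / 2^j contains a whole dyadic lap of level
j, which f^j maps onto the space. *)
Lemma tent_covers (A : set X) a b j (y : X) : connected A -> A a -> A b ->
  2 / 2 ^+ j <= ucoord b - ucoord a -> exists2 z, A z & iter j tent_cmap z = y.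
Proof.
move=> cA Aa Ab; have j0 : 0 < 2 ^+ j :> R by rewrite exprn_gt0.
rewrite ler_pdivrMr// => ab.
(* The first dyadic point of level j beyond a; the lap starts there. *)
set s := (Num.truncn (2 ^+ j * ucoord a)).+1.
have /truncn_itv/andP[] : 0 <= 2 ^+ j * ucoord a by rewrite mulr_ge0 ?ucoord_ge0 ?ltW.
rewrite -/s => sa as_.
have {}sa : s%:R <= 2 ^+ j * ucoord a + 1 by rewrite /s -natr1 lerD2r.
have b1 := ucoord_le1 b; have y0 := ucoord_ge0 y; have y1 := ucoord_le1 y.
have bj : 2 ^+ j * ucoord b <= 2 ^+ j by rewrite ler_piMr// ltW.
have sj : (s < 2 ^ j)%N by rewrite -(ler_nat R) natrX -natr1; lra.
pose t := if odd s then 1 - ucoord y else ucoord y.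
have t01 : 0 <= t <= 1 by rewrite /t; case: odd; apply/andP; split; lra.
have [t0 t1] := andP t01; pose x := (s%:R + t) / 2 ^+ j.
have ax : ucoord a <= x by rewrite ler_pdivlMr//; lra.
have xb : x <= ucoord b by rewrite ler_pdivrMr//; lra.
have xK : ucoord (to_unit x) = x.
  by rewrite to_unitK// (le_trans (ucoord_ge0 a) ax) (le_trans xb).
exists (to_unit x); first by apply: connected_ucoordP cA Aa Ab _; rewrite xK ax.
apply: ucoord_inj; rewrite (ucoord_iter_unit_map tent_map) xK iter_tent_lap//.
by rewrite /t; case: odd => //; rewrite subKr.
Qed.

Section upper_bound.
Variables (N n : nat).

(** A time by which an interval of length [w] has been mapped onto the whole
space, cut off at [n]. *)
Definition covering_time (w : R) := find (fun i => 2 / 2 ^+ i <= w) (iota 0 n).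

Lemma covering_time_le w : (covering_time w <= n)%N.
Proof. by rewrite -[leqRHS](size_iota 0); exact: find_size. Qed.

Lemma covering_timeP w j : (covering_time w <= j < n)%N -> 2 / 2 ^+ j <= w.
Proof.
move=> /andP[kj jn]; have kn : (covering_time w < n)%N := leq_ltn_trans kj jn.
have : has (fun i => 2 / 2 ^+ i <= w) (iota 0 n) by rewrite has_find size_iota.
move=> /(nth_find 0); rewrite -/(covering_time w) nth_iota// add0n.
apply: le_trans; rewrite ler_pM2l// lef_pV2 ?posrE ?exprn_gt0//.
by rewrite ler_weXn2l// ler1n.
Qed.

Lemma before_covering_time w : w <= 1 -> 2 ^+ covering_time w * w <= 4.
Proof.
move=> w1; case kE : (covering_time w) => [|k]; first by rewrite expr0 mul1r; lra.
have kn : (k < n)%N by rewrite (leq_trans _ (covering_time_le w))// kE.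
have /(before_find 0)/negbT : (k < covering_time w)%N by rewrite kE.
rewrite nth_iota// add0n -ltNge ltr_pdivlMr ?exprn_gt0// exprS => *; lra.
Qed.

Definition scale (x y : X) := covering_time (ucoord y - ucoord x).
(** The first k + N binary digits of a point; N is the precision that remains
after k steps of the tent map, each of which consumes one digit. *)
Definition digits (k : nat) (x : X) := Num.truncn (2 ^+ (k + N) * ucoord x).

(** An injective numbering of all pairs (k, u) with u <= 2^(k + N), by successive
blocks. It keeps the total number of classes proportional to 2^n, where
recording k and u separately would cost a further factor n. *)
Definition tree_code k u := (2 ^ (k + N) + k + u)%N.

Lemma digits_le k x : (digits k x <= 2 ^ (k + N))%N.
Proof.
rewrite /digits truncn_le_nat (@le_lt_trans _ _ (2 ^ (k + N))%:R) ?ltr_nat//.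
by rewrite natrX ler_piMr ?ucoord_le1// exprn_ge0.
Qed.

Lemma digits_close k x y : digits k x = digits k y ->
  2 ^+ k * `|ucoord x - ucoord y| <= 2^-1 ^+ N.
Proof.
rewrite /digits; set s := ucoord x; set t := ucoord y => st.
have kN0 : 0 < 2 ^+ (k + N) :> R by rewrite exprn_gt0.
have /truncn_itv : 0 <= 2 ^+ (k + N) * s by rewrite mulr_ge0 ?ucoord_ge0 ?ltW.
have /truncn_itv : 0 <= 2 ^+ (k + N) * t by rewrite mulr_ge0 ?ucoord_ge0 ?ltW.
rewrite st -natr1 => /andP[? ?] /andP[? ?].
rewrite exprVn -[leRHS]mul1r ler_pdivlMr ?exprn_gt0// mulrAC -exprD.
rewrite -[X in X * _]gtr0_norm// -normrM mulrBr ler_norml.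
by apply/andP; split; lra.
Qed.

Lemma digits_homo k x y : ucoord x <= ucoord y -> (digits k x <= digits k y)%N.
Proof. by move=> xy; rewrite le_truncn// ler_wpM2l// exprn_ge0. Qed.

Lemma tree_code_inj k u k' u' : (u <= 2 ^ (k + N))%N -> (u' <= 2 ^ (k' + N))%N ->
  tree_code k u = tree_code k' u' -> k = k' /\ u = u'.
Proof.
wlog kk' : k u k' u' / (k <= k')%N.
  move=> wlg ule u'le E; have [kk'|/ltnW kk'] := leqP k k'; first exact: wlg.
  by have [-> ->] := wlg _ _ _ _ kk' u'le ule (esym E).
rewrite /tree_code => ule u'le; move: kk'; rewrite leq_eqVlt => /predU1P[->|kk'].
  by move=> /addnI.
have : (2 ^ (k + N).+1 <= 2 ^ (k' + N))%N by rewrite leq_pexp2l// -addSn leq_add2r.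
rewrite expnS; lia.
Qed.

(** An interval of covering time k has length at most 4 / 2^k, so its right end
is found within boundedly many dyadic steps of its left end. *)
Lemma width_le x y : ucoord x <= ucoord y ->
  (digits (scale x y) y - digits (scale x y) x <= 4 * 2 ^ N)%N.
Proof.
move=> xy; have := @before_covering_time (ucoord y - ucoord x).
rewrite -/(scale x y); set k := scale x y.
have xy1 : ucoord y - ucoord x <= 1.
  by have := ucoord_ge0 x; have := ucoord_le1 y; lra.
move=> /(_ xy1) kxy; have kN0 : 0 < 2 ^+ (k + N) :> R by rewrite exprn_gt0.
have /truncn_itv : 0 <= 2 ^+ (k + N) * ucoord x by rewrite mulr_ge0 ?ucoord_ge0 ?ltW.
have /truncn_itv : 0 <= 2 ^+ (k + N) * ucoord y by rewrite mulr_ge0 ?ucoord_ge0 ?ltW.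
rewrite -/(digits k x) -/(digits k y) -natr1 => /andP[yl _] /andP[_ xr].
have : 2 ^+ (k + N) * (ucoord y - ucoord x) <= 4 * 2 ^+ N.
  by rewrite exprD mulrAC ler_pM2r// exprn_gt0.
rewrite mulrBr => yx; rewrite leq_subLR -ltnS -(ltr_nat R) -natr1 natrD natrM natrX.
lra.
Qed.

End upper_bound.

(** A connected set is classified by its covering time, the digits of its left
end up to that time, and its width in dyadic units. Two sets in the same class
stay close before the covering time, as their ends share enough digits, and
afterwards both fill the whole space. *)
Lemma sep_tent_le k n N (e : R) : 2^-1 ^+ N < e ->
  (sep (ncomp_map tent_cmap k) n e <=
   ((2 ^ (n + N + 2) * (4 * 2 ^ N).+1) ^ k)%:R%:E)%E.
Proof.
move=> Ne; have N0 : 0 < 2^-1 ^+ N :> R by rewrite exprn_gt0// invr_gt0.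
have [ends endsP] := @hyperspace_ends R.
pose P := (2 ^ (n + N).+1 + n)%N.
pose sc (A : hyperspace X) := scale n (ends A).1 (ends A).2.
pose lo (A : hyperspace X) := digits N (sc A) (ends A).1.
pose hi (A : hyperspace X) := digits N (sc A) (ends A).2.
pose cl (A : hyperspace X) : 'I_P.+1 * 'I_(4 * 2 ^ N).+1 :=
  (inord (tree_code N (sc A) (lo A)), inord (hi A - lo A)).
have sc_le A : (sc A <= n)%N by exact: covering_time_le.
have ends_le A : ucoord (ends A).1 <= ucoord (ends A).2.
  by have [Aa Ab Aab] := endsP A; have /andP[] := Aab _ Ab.
have code_le A : (tree_code N (sc A) (lo A) <= P)%N.
  rewrite /tree_code /P; have := digits_le N (sc A) (ends A).1; rewrite -/(lo A).
  have := sc_le A; have : (2 ^ (sc A + N) <= 2 ^ (n + N))%N.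
    by rewrite leq_pexp2l// leq_add2r.
  rewrite expnS; lia.
have clE A B : cl A = cl B -> [/\ sc A = sc B, lo A = lo B & hi A = hi B].
  move=> [/(congr1 val) + /(congr1 val)]; rewrite /= !inordK ?ltnS ?width_le//.
  move=> /tree_code_inj[||scE loE hiE]; [exact: digits_le|exact: digits_le|].
  have := digits_homo N (sc A) (ends_le A); have := digits_homo N (sc B) (ends_le B).
  by rewrite -/(lo A) -/(hi A) -/(lo B) -/(hi B) => ? ?; split => //; lia.
apply: (@le_trans _ _ (#|{: 'I_P.+1 * 'I_(4 * 2 ^ N).+1}| ^ k)%:R%:E); last first.
  rewrite lee_fin ler_nat card_prod !card_ord; case: k => // k.
  rewrite leq_exp2r// leq_mul2r; apply/orP; right.
  have := ltn_expl (n + N).+1 (isT : 1 < 2)%N.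
  rewrite /P addn2 [(2 ^ (n + N).+2)%N]expnS; lia.
apply: (@sep_ncomp_le _ _ _ _ cl _ _ _ _ (lt_trans N0 Ne) Ne) => A B cA cB.
move=> /clE[scE loE hiE] j jn.
have [Aa Ab Aab] := endsP A; have [Bc Bd _] := endsP B.
have [scj|jsc] := leqP (sc A) j.
  move=> z _; have /covering_timeP : (sc B <= j < n)%N by rewrite -scE scj.
  move=> /(tent_covers (iter j tent_cmap z) cB Bc Bd)[w Bw <-].
  by exists w => //; rewrite mdistxx ltW.
have close x y z : digits N (sc A) x = digits N (sc A) y ->
    `|ucoord z - ucoord y| <= `|ucoord x - ucoord y| ->
    mdist (iter j tent_cmap z) (iter j tent_cmap y) <= 2^-1 ^+ N.
  move=> /digits_close xy zy; rewrite mdist_ucoord !(ucoord_iter_unit_map tent_map).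
  apply: le_trans (iter_imap_lip tent_map _ _ _) _; apply: le_trans xy.
  by rewrite ler_pM ?exprn_ge0// ler_weXn2l ?ler1n// ltnW.
apply: (connected_compare (ltW N0) cB Bc Bd Aab) => z /andP[z1 z2].
  apply: (close (ends A).1); first by rewrite -/(lo A) loE /lo scE.
  by rewrite ler0_norm ?subr_le0// ler0_norm ?subr_le0 ?(le_trans z1)//; lra.
apply: (close (ends A).2); first by rewrite -/(hi A) hiE /hi scE.
by rewrite ger0_norm ?subr_ge0// ger0_norm ?subr_ge0 ?(le_trans z1)//; lra.
Qed.

Lemma top_entropy_tent_le k :
  (entropy_at_rate (fun n => n%:R) (ncomp_map tent_cmap k) <= (k%:R * ln 2)%:E)%E.
Proof.
apply: (entropy_at_rate_le (@ler0n R) cvgr_idn) => e e0.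
pose N := (Num.truncn e^-1).+1.
have Ne : 2^-1 ^+ N < e.
  rewrite exprVn invf_plt ?posrE ?exprn_gt0// (lt_trans (truncnS_gt _))//.
  by rewrite -natrX ltr_nat ltn_expl.
exists (k%:R * ln (2 ^ (N + 2) * (4 * 2 ^ N).+1)%:R) => n n0.
apply: le_trans (lne_sep_le _ (@sep_tent_le k n N e Ne)) _.
  by rewrite expn_gt0 muln_gt0 expn_gt0.
have M0 : (0 < 2 ^ (N + 2) * (4 * 2 ^ N).+1)%N by rewrite muln_gt0 expn_gt0.
rewrite lee_fin -addnA expnD -mulnA natrX lnXn ?ltr0n ?muln_gt0 ?expn_gt0//.
rewrite natrM lnM ?posrE ?ltr0n// ?expn_gt0// natrX lnXn//.
by rewrite -[leLHS]mulr_natl mulrDr -[ln 2 *+ n]mulr_natr mulrA.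
Qed.

Section itineraries.
Variable N : nat.

(** The point whose successive images under f^N lie in the laps of level N of
even index 2s, for s along [w]. Distinct even laps are at distance at least 2^-N,
and f^N is increasing on them. *)
Definition coded_point (w : seq nat) : R :=
  foldr (fun s x => ((2 * s)%:R + x) / 2 ^+ N) 0 w.

Definition admissible := all (fun s => 2 * s < 2 ^ N)%N.

Lemma coded_point_in01 w : admissible w -> 0 <= coded_point w <= 1.
Proof.
elim: w => [|s w IHw] /=; first by rewrite lexx ler01.
move=> /andP[sN /IHw /andP[x0 x1]]; have N0 : 0 < 2 ^+ N :> R by rewrite exprn_gt0.
apply/andP; split; first by rewrite divr_ge0 ?addr_ge0// ltW.
rewrite ler_pdivrMr// mul1r -natrX.
by rewrite (@le_trans _ _ (2 * s).+1%:R) ?ler_nat// -natr1 lerD2l.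
Qed.

Lemma iter_tent_coded_point j w : admissible w ->
  iter (N * j) tent (coded_point w) = coded_point (drop j w).
Proof.
elim: j w => [|j IHj] w; first by rewrite muln0 drop0.
rewrite mulnSr iterD; case: w => [_|s w /= /andP[sN wN]].
  have iter0 i : iter i tent 0 = 0.
    elim: i => //= i ->; rewrite /tent mulr0 subr0 min_l//.
  by rewrite iter0/= iter0.
by rewrite iter_tent_lap ?coded_point_in01// mul2n odd_double/= IHj.
Qed.

Lemma coded_point_separated s t v w : admissible v -> admissible w -> s != t ->
  2^-1 ^+ N <= `|coded_point (s :: v) - coded_point (t :: w)|.
Proof.
move=> /coded_point_in01/andP[v0 v1] /coded_point_in01/andP[w0 w1] st /=.
have N0 : 0 < 2 ^+ N :> R by rewrite exprn_gt0.
rewrite -mulrBl normrM [X in _ * X]gtr0_norm ?invr_gt0// exprVn ler_pMl ?invr_gt0//.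
rewrite !natrM; have [s_lt|t_lt|/eqP] := ltngtP s t; last by rewrite (negPf st).
  have : s%:R + 1 <= t%:R :> R by rewrite natr1 ler_nat.
  by rewrite ler_normr => *; apply/orP; right; lra.
have : t%:R + 1 <= s%:R :> R by rewrite natr1 ler_nat.
by rewrite ler_normr => *; apply/orP; left; lra.
Qed.

End itineraries.

(** The letters are the numbers below (k+1) M, and the i-th point only uses the
i-th block of M letters. At the time where two codes differ at place (i, j), the
i-th point of one set sits in a lap visited by no point of the other set: not by
the i-th one, since the codes differ, and not by another one, since the blocks
are disjoint. *)
Lemma sep_tent_ge k l N M : (0 < N)%N -> (2 * (k.+1 * M) <= 2 ^ N)%N ->
  ((M ^ (k.+1 * l))%:R%:E <=
   sep (ncomp_map tent_cmap k.+1) (N * l) (2^-1 ^+ N))%E.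
Proof.
move=> N0 MN.
pose word (w : {ffun 'I_k.+1 * 'I_l -> 'I_M}) (i : 'I_k.+1) :=
  [seq (i * M + w (i, j))%N | j <- enum 'I_l].
have wordN w i : admissible N (word w i).
  apply/allP => _ /mapP[j _ ->]; apply: leq_trans MN; rewrite ltn_pmul2l//.
  apply: (@leq_trans (i.+1 * M)); last by rewrite leq_mul2r ltn_ord orbT.
  by rewrite mulSn addnC ltn_add2r.
have wordE w i (j : 'I_l) :
    drop j (word w i) = (i * M + w (i, j))%N :: drop j.+1 (word w i).
  rewrite (drop_nth 0%N); last by rewrite size_map size_enum_ord.
  by rewrite (nth_map j) ?size_enum_ord// nth_ord_enum.
pose pt w i := coded_point N (word w i).
have pt01 w i : 0 <= pt w i <= 1 by exact: coded_point_in01.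
have [A_ AP] := choice (fun w =>
  let: ex_intro2 A Ak AE := @interval_union R k (pt w) (pt w)
    (fun i => let: conj p0 p1 := andP (pt01 w i) in conj p0 (conj (lexx _) p1))
  in ex_intro _ A (conj Ak AE)).
have -> : (M ^ (k.+1 * l))%N = #|{: {ffun 'I_k.+1 * 'I_l -> 'I_M}}|.
  by rewrite card_ffun card_prod !card_ord.
apply: (@sep_ncomp_ge _ _ _ _ A_).
- by rewrite exprn_gt0// invr_gt0.
- by move=> w; case: (AP w).
move=> v w vw; have /existsP[[i j] vwij] : [exists ij, v ij != w ij].
  by apply: contraNT vw => /existsPn vw; apply/eqP/ffunP => ij; apply/eqP/negPn.
have [[_ vE] [_ wE]] := (AP v, AP w).
have jl : (N * j < N * l)%N by rewrite ltn_pmul2l.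
apply: (dynamic_dist_hyper_ge jl (a := to_unit (pt v i))).
  by rewrite vE; exists i; rewrite to_unitK// lexx.
move=> y; rewrite wE => -[i']; rewrite -eq_le => /eqP yE.
rewrite mdist_ucoord !(ucoord_iter_unit_map tent_map) to_unitK// -yE.
rewrite !iter_tent_coded_point// !wordE; apply: coded_point_separated.
- by apply/allP => s /mem_drop; move/allP: (wordN v i); apply.
- by apply/allP => s /mem_drop; move/allP: (wordN w i'); apply.
- apply: contraNneq vwij => E; have M0 : (0 < M)%N by case: (M) (v (i, j)) => [[]|].
  have ii' : i = i'.
    apply: val_inj; have := congr1 (divn^~ M) E.
    by rewrite !divnMDl// !divn_small// !addn0.
  by apply/eqP/val_inj; move: E; rewrite ii' => /addnI.
Qed.

Lemma top_entropy_tent_ge k N M : (0 < N)%N -> (0 < M)%N ->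
  (2 * (k.+1 * M) <= 2 ^ N)%N ->
  ((k.+1%:R * ln M%:R / N%:R)%:E <=
   entropy_at_rate (fun n => n%:R) (ncomp_map tent_cmap k.+1))%E.
Proof.
move=> N0 M0 MN.
apply: (@entropy_at_rate_ge _ _ (@ler0n R) cvgr_idn _ _ _ 0 (2^-1 ^+ N)
  (fun l => N * l)%N).
- by rewrite exprn_gt0// invr_gt0.
- by move=> l; rewrite leq_pmull.
- move=> l l0; apply: le_trans (lne_sep_ge _ (sep_tent_ge l N0 MN)); last first.
    by rewrite expn_gt0 M0.
  rewrite lee_fin subr0 natrX lnXn ?ltr0n// -[leRHS]mulr_natl !natrM.
  rewrite [leLHS](_ : _ = k.+1%:R * l%:R * ln M%:R)//.
  by field; rewrite pnatr_eq0 -lt0n.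
Qed.

Lemma top_entropy_tent_lt k : (0 < k)%N ->
  (entropy_at_rate (fun n => n%:R) (ncomp_map tent_cmap k) <
   entropy_at_rate (fun n => n%:R) (ncomp_map tent_cmap k.+1))%E.
Proof.
(* With M = 2^q and N = q + p the entropy is at least (k+1) q / (q + p) times
   log 2, which exceeds k log 2 as soon as q > k p; p = k + 2 ensures
   2 (k+1) <= 2^p. *)
move=> k0; pose q := (k * k.+2).+1; pose N := (q + k.+2)%N.
apply: le_lt_trans (top_entropy_tent_le k) _.
have N0 : (0 < N)%N by rewrite /N addnS.
apply: lt_le_trans (@top_entropy_tent_ge k N (2 ^ q) N0 _ _).
- rewrite lte_fin natrX lnXn// ltr_pdivlMr ?ltr0n// -[ln 2 *+ q]mulr_natr.
  rewrite [ltLHS](_ : _ = ln 2 * (k * N)%:R); last by rewrite natrM; ring.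
  rewrite [ltRHS](_ : _ = ln 2 * (k.+1 * q)%:R); last by rewrite natrM; ring.
  by rewrite ltr_pM2l ?ln_gt0 ?ltr1n// ltr_nat /N /q; nia.
- by rewrite expn_gt0.
- rewrite mulnA expnD mulnC leq_mul2l; apply/orP; right.
  by rewrite expnS leq_mul2l/=; exact/ltnW/ltn_expl.
Qed.

End tent.

(** * The map min(1, 2x) *)

Section doubling_cut_off.
Context {R : realType}.
Local Notation X := (unit_interval R).

Definition double_cap (x : R) : R := Num.min 1 (2 * x).

Lemma double_cap_in01 x : 0 <= x <= 1 -> 0 <= double_cap x <= 1.
Proof.
by rewrite /double_cap le_min ge_min lexx => /andP[x0 _]; rewrite ler01 mulr_ge0.
Qed.

Lemma double_cap_lip x y : `|double_cap x - double_cap y| <= 2 * `|x - y|.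
Proof.
have := ler_norm (x - y); have := ler_norm (y - x); rewrite (distrC y x) /double_cap.
by rewrite /Num.min; do ![case: ifPn]; rewrite -?leNgt => *;
  rewrite ler_norml; apply/andP; split; lra.
Qed.

Definition double_cap_map : interval_map := IntervalMap double_cap_in01 double_cap_lip.

Definition double_cap_cmap : continuousType X X := unit_cmap double_cap_map.

Lemma iter_double_cap j (x : R) : x <= 1 -> iter j double_cap x = Num.min 1 (2 ^+ j * x).
Proof.
move=> x1; elim: j => [|j IHj]; first by rewrite expr0 mul1r min_r.
rewrite iterS IHj /double_cap exprS -mulrA; set t := 2 ^+ j * x.
by rewrite /Num.min; do ![case: ifPn]; rewrite -?leNgt => *; lra.
Qed.

Lemma iter_double_cap_homo j : {homo iter j double_cap : x y / x <= y}.
Proof.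
elim: j => // j IHj x y xy; rewrite !iterS /double_cap.
have := IHj _ _ xy; set s := iter j double_cap x; set t := iter j double_cap y => st.
by rewrite /Num.min; do ![case: ifPn]; rewrite -?leNgt => *; lra.
Qed.

Section upper_bound.
Variables (K n : nat).
Hypothesis K0 : (0 < K)%N.

(** The sum over times of the discretised orbit. All iterates being
nondecreasing, the summands of two points are comparable all in the same
direction, so that equality of the sums forces equality of every summand: the
sum, with only n K + 1 possible values, encodes the whole orbit at precision
1 / K. *)
Definition cell (x : X) : nat :=
  (\sum_(j < n) Num.truncn (K%:R * ucoord (iter j double_cap_cmap x)))%N.

Lemma cell_le x : (cell x <= n * K)%N.
Proof.
rewrite -[X in (_ <= X * _)%N]card_ord -sum_nat_const leq_sum// => j _.
rewrite truncn_le_nat (@le_lt_trans _ _ K%:R) ?ltr_nat//.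
by rewrite ler_piMr ?ler0n ?ucoord_le1.
Qed.

Lemma cell_close x y j : (j < n)%N -> cell x = cell y ->
  mdist (iter j double_cap_cmap x) (iter j double_cap_cmap y) <= K%:R^-1.
Proof.
wlog xy : x y / ucoord x <= ucoord y.
  move=> wlg; have [/wlg//|/ltW/wlg yx jn xy] := leP (ucoord x) (ucoord y).
  by rewrite metric_sym yx.
pose T j x := Num.truncn (K%:R * ucoord (iter j double_cap_cmap x)).
have K0R : 0 < K%:R :> R by rewrite ltr0n.
have Tle (i : 'I_n) : (T i x <= T i y)%N.
  rewrite le_truncn// ler_pM2l// !(ucoord_iter_unit_map double_cap_map).
  exact: iter_double_cap_homo.
move=> jn xyE.
have /(_ (Ordinal jn) isT)/=/eqP : forall i : 'I_n, true -> T i x == T i y.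
  have /leqif_sum [_] : forall i : 'I_n, true ->
      (T i x <= T i y ?= iff (T i x == T i y))%N.
    by move=> i _; exact: leqif_eq.
  by rewrite -/(cell x) -/(cell y) xyE eqxx => /esym/forall_inP.
rewrite /T mdist_ucoord; set s := ucoord _; set t := ucoord _ => Tst.
have s0 : 0 <= K%:R * s by rewrite mulr_ge0 ?ucoord_ge0.
have t0 : 0 <= K%:R * t by rewrite mulr_ge0 ?ucoord_ge0.
have := truncn_itv s0; have := truncn_itv t0; rewrite Tst.
rewrite -(ler_pM2l K0R) mulfV ?gt_eqF// -[X in X * `|_|]gtr0_norm// -normrM.
rewrite mulrBr -natr1 ler_norml => /andP[? ?] /andP[? ?].
by apply/andP; split; lra.
Qed.

End upper_bound.

Lemma sep_double_cap_le k n (K : nat) (e : R) : (0 < K)%N -> K%:R^-1 < e ->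
  (sep (ncomp_map double_cap_cmap k) n e <= ((n * K).+1 ^ (2 * k))%:R%:E)%E.
Proof.
move=> K0 Ke; have Ki0 : 0 < K%:R^-1 :> R by rewrite invr_gt0 ltr0n.
have [ends endsP] := @hyperspace_ends R.
pose code (x : X) : 'I_(n * K).+1 := inord (cell K n x).
have codeE x y : code x = code y -> cell K n x = cell K n y.
  by move=> /(congr1 val); rewrite /= !inordK// ltnS cell_le.
have -> : ((n * K).+1 ^ (2 * k))%N = (#|{: 'I_(n * K).+1 * 'I_(n * K).+1}| ^ k)%N.
  by rewrite card_prod card_ord mulnn expnM.
apply: (@sep_ncomp_le _ _ _ _ (fun A => (code (ends A).1, code (ends A).2)) _ _
  _ _ (lt_trans Ki0 Ke) Ke) => A B cA cB [/codeE loE /codeE hiE] j jn.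
have [Aa Ab Aab] := endsP A; have [Bc Bd _] := endsP B.
have close z x y : cell K n x = cell K n y -> ucoord x <= ucoord z <= ucoord y ->
    mdist (iter j double_cap_cmap z) (iter j double_cap_cmap y) <= K%:R^-1 /\
    mdist (iter j double_cap_cmap z) (iter j double_cap_cmap x) <= K%:R^-1.
  move=> xyE /andP[xz zy]; have := cell_close K0 jn xyE.
  rewrite !mdist_ucoord !(ucoord_iter_unit_map double_cap_map).
  have := iter_double_cap_homo j xz; have := iter_double_cap_homo j zy => ? ?.
  by rewrite !ler_norml => /andP[? ?]; split; apply/andP; split; lra.
apply: (connected_compare (ltW Ki0) cB Bc Bd Aab) => z /close.
  by case/(_ loE).
by case/(_ (esym hiE)).
Qed.

Lemma ln_natr_ge0 n : 0 <= ln n%:R :> R.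
Proof. by case: n => [|n]; [rewrite ln0|rewrite ln_ge0// ler1n]. Qed.

Lemma ln_natr_cvgy : (ln n%:R : R) @[n --> \oo] --> +oo.
Proof.
apply/cvgryPge => A; have /cvgryPge/(_ (expR A)) := @cvgr_idn R.
apply: filterS => n An.
by rewrite -(expRK A) ler_ln// posrE ?expR_gt0// (lt_le_trans (expR_gt0 A)).
Qed.

Lemma pol_entropy_double_cap_le k :
  (entropy_at_rate (fun n => ln n%:R) (ncomp_map double_cap_cmap k) <= (2 * k)%:R%:E)%E.
Proof.
apply: (entropy_at_rate_le ln_natr_ge0 ln_natr_cvgy) => e e0.
pose K := (Num.truncn e^-1).+1.
have Ke : K%:R^-1 < e.
  by rewrite invf_plt ?posrE// ?ltr0n//; exact: truncnS_gt.
exists ((2 * k)%:R * ln K.+1%:R) => n n0.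
apply: le_trans (lne_sep_le _ (@sep_double_cap_le k n K e isT Ke)) _.
  by rewrite expn_gt0.
have nK0 : (0 < n * K.+1)%N by rewrite muln_gt0 n0.
rewrite lee_fin -mulrDr -lnM ?posrE ?ltr0n// -natrM natrX lnXn ?ltr0n//.
rewrite -[leLHS]mulr_natl ler_wpM2l// ler_ln ?posrE ?ltr0n// ler_nat.
by rewrite mulnS -addn1 addnC leq_add2r.
Qed.

Section separated_unions.
Variables (k l : nat) (w : {ffun 'I_k.+1 * bool -> 'I_l}).

(** A code [w] places the two ends of the i-th run of consecutive times freely
in the blocks of times number 2i and 2i + 1, of length [l] each. As distinct runs
use distinct blocks, a code is recovered from the union of its runs
([in_run_inj]). *)
Definition run_start (i : 'I_k.+1) : nat := (2 * i * l + w (i, false))%N.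
Definition run_end (i : 'I_k.+1) : nat := ((2 * i).+1 * l + w (i, true))%N.

Definition in_run (t : nat) := [exists i, run_start i <= t < run_end i]%N.

Lemma run_startP (i : 'I_k.+1) : (2 * i * l <= run_start i < (2 * i).+1 * l)%N.
Proof. by rewrite leq_addr mulSn addnC ltn_add2l ltn_ord. Qed.

Lemma run_endP (i : 'I_k.+1) : ((2 * i).+1 * l <= run_end i < (2 * i.+1) * l)%N.
Proof.
by rewrite leq_addr mulnS add2n [((2 * i).+2 * l)%N]mulSn addnC ltn_add2l ltn_ord.
Qed.

(** In the block number 2i only the i-th run can be entered. *)
Lemma in_run_lower (i : 'I_k.+1) t : (2 * i * l <= t < (2 * i).+1 * l)%N ->
  in_run t = (run_start i <= t)%N.
Proof.
move=> /andP[it ti]; apply/existsP/idP => [[j /andP[jt tj]]|st]; last first.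
  by exists i; rewrite st (leq_trans ti)//; have /andP[] := run_endP i.
have /andP[js _] := run_startP j; have /andP[_ je] := run_endP j.
have [ji|ij|/val_inj <-//] := ltngtP j i.
- have := leq_mul2r l (2 * j.+1) (2 * i); rewrite leq_mul2l ji !orbT => jil.
  by have := leq_trans (ltn_trans tj je) (leq_trans jil it); rewrite ltnn.
- have := leq_mul2r l (2 * i.+1) (2 * j); rewrite leq_mul2l ij !orbT => ijl.
  have : (t < 2 * i.+1 * l)%N.
    by apply: leq_trans ti _; rewrite leq_mul2r; apply/orP; right; lia.
  by rewrite ltnNge (leq_trans ijl)// (leq_trans js).
Qed.

(** In the block number 2i + 1 only the i-th run can be left. *)
Lemma in_run_upper (i : 'I_k.+1) t : ((2 * i).+1 * l <= t < 2 * i.+1 * l)%N ->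
  in_run t = (t < run_end i)%N.
Proof.
move=> /andP[it ti]; apply/existsP/idP => [[j /andP[jt tj]]|st]; last first.
  by exists i; rewrite st andbT (leq_trans _ it)//; have /andP[_ /ltnW] := run_startP i.
have /andP[js _] := run_startP j; have /andP[_ je] := run_endP j.
have [ji|ij|/val_inj <-//] := ltngtP j i.
- have := leq_mul2r l (2 * j.+1) (2 * i); rewrite leq_mul2l ji !orbT => jil.
  have : (2 * i * l <= t)%N.
    by apply: leq_trans it; rewrite leq_mul2r leqnSn orbT.
  by rewrite leqNgt (leq_trans (ltn_trans tj je) jil).
- have := leq_mul2r l (2 * i.+1) (2 * j); rewrite leq_mul2l ij !orbT => ijl.
  by have := leq_trans (leq_trans ti ijl) (leq_trans js jt); rewrite ltnn.
Qed.

Lemma run_hyperspace : exists2 A : hyperspace X, ncomp_hyperspace X k.+1 A &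
  hset A = [set x | exists i,
    2^-1 ^+ run_end i <= ucoord x <= 2^-1 ^+ run_start i].
Proof.
have half01 : 0 <= (2^-1 : R) <= 1 by rewrite invr_ge0 invf_le1// ler1n ler0n.
have [half0 half1] := andP half01.
apply: interval_union => i; rewrite exprn_ge0// exprn_ile1//; split => //; split => //.
apply: ler_wiXn2l => //; have /andP[_ /ltnW se] := run_startP i.
by apply: leq_trans se _; have /andP[] := run_endP i.
Qed.

End separated_unions.

(** At the first of the two differing starts, or of the two differing ends, exactly
one of the two codes is inside a run. *)
Lemma in_run_inj k l (v w : {ffun 'I_k.+1 * bool -> 'I_l}) : v != w ->
  exists2 t, (t < 2 * k.+1 * l)%N & in_run v t != in_run w t.
Proof.
move=> vw; have /existsP[[i b] vwi] : [exists ib, v ib != w ib].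
  by apply: contraNT vw => /existsPn vw; apply/eqP/ffunP => ib; apply/eqP/negPn.
wlog vwlt : v w vw vwi / (v (i, b) < w (i, b))%N.
  move=> wlg; have [/wlg|wv|/val_inj/eqP] := ltngtP (v (i, b)) (w (i, b)).
  - exact.
  - have [t tl] : exists2 t, (t < 2 * k.+1 * l)%N & in_run w t != in_run v t.
      by apply: wlg => //; rewrite eq_sym.
    by rewrite eq_sym; exists t.
  - by rewrite (negPf vwi).
have il : (2 * i.+1 * l <= 2 * k.+1 * l)%N by rewrite leq_mul2r leq_mul2l ltn_ord !orbT.
case: b vwi vwlt => _ vw_lt.
  have te := run_endP v i; exists (run_end v i).
    by apply: leq_trans il; have /andP[] := te.
  by rewrite !(in_run_upper _ te) ltnn ltn_add2l vw_lt.
have ts := run_startP v i; exists (run_start v i).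
  apply: leq_trans il; apply: (@leq_trans ((2 * i).+1 * l)); first by have /andP[] := ts.
  by rewrite leq_mul2r; apply/orP; right; lia.
by rewrite !(in_run_lower _ ts) leqnn leq_add2l leqNgt vw_lt.
Qed.

(** The i-th interval joins 2^-(end of the run) to 2^-(start of the run), so that the
set contains the fundamental domain from 2^-(t+1) to 2^-t when t lies in a run and
misses its interior otherwise. At a time t that tells two codes apart, the middle of this domain
is sent by f^t to 3/4, whereas the image under f^t of the other set avoids the open
interval from 1/2 to 1. *)
Lemma sep_double_cap_ge k l :
  ((l ^ (2 * k.+1))%:R%:E <= sep (ncomp_map double_cap_cmap k.+1) (2 * k.+1 * l) 4^-1)%E.
Proof.
have [A_ AP] := choice (fun w : {ffun 'I_k.+1 * bool -> 'I_l} =>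
  let: ex_intro2 A Ak AE := run_hyperspace w in ex_intro _ A (conj Ak AE)).
have -> : (l ^ (2 * k.+1))%N = #|{: {ffun 'I_k.+1 * bool -> 'I_l}}|.
  by rewrite card_ffun card_prod card_bool !card_ord mulnC.
apply: (@sep_ncomp_ge _ _ _ _ A_); [by rewrite invr_gt0|by move=> w; case: (AP w)|].
move=> v w /in_run_inj[t tl].
wlog [vt wt] : v w / in_run v t /\ ~~ in_run w t.
  move=> wlg; case vt: (in_run v t); case wt: (in_run w t) => // _.
    by apply: wlg; rewrite vt wt.
  by rewrite dynamic_dist_sym; apply: wlg; rewrite vt wt.
move=> _; have [[_ vE] [_ wE]] := (AP v, AP w).
have half0 : 0 < 2^-1 :> R by rewrite invr_gt0.
have half1 : 2^-1 <= 1 :> R by rewrite invf_le1// ler1n.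
have ht0 s : 0 < 2^-1 ^+ s :> R by rewrite exprn_gt0.
have ht1 s : 2^-1 ^+ s <= 1 :> R by rewrite exprn_ile1// ltW.
have hS s : 2^-1 ^+ s.+1 = 2^-1 * 2^-1 ^+ s :> R by rewrite exprS.
have hK : 2 ^+ t * 2^-1 ^+ t = 1 :> R by rewrite -exprMn mulfV// expr1n.
have t2 : 0 < 2 ^+ t :> R by rewrite exprn_gt0.
pose x : R := 3 / 4 * 2^-1 ^+ t.
have x01 : 0 <= x <= 1.
  by have := ht0 t; have := ht1 t; rewrite /x => *; apply/andP; split; lra.
apply: (dynamic_dist_hyper_ge tl (a := to_unit x)).
  rewrite vE; have /existsP[i /andP[st te]] := vt; exists i; rewrite to_unitK//.
  apply/andP; split.
    apply: (@le_trans _ _ (2^-1 ^+ t.+1)); first by rewrite ler_wiXn2l// ltW.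
    by rewrite hS /x; have := ht0 t; lra.
  apply: (@le_trans _ _ (2^-1 ^+ t)); last by rewrite ler_wiXn2l// ltW.
  by rewrite /x; have := ht0 t; lra.
move=> y; rewrite wE => -[i /andP[ey ys]].
rewrite mdist_ucoord !(ucoord_iter_unit_map double_cap_map) to_unitK//.
rewrite !iter_double_cap ?ucoord_le1//; last by case/andP: x01.
rewrite {1}/x mulrCA hK mulr1 min_r; last lra.
have /existsPn/(_ i) := wt; rewrite negb_and -ltnNge -leqNgt => /orP[ts|et].
  have : 2 ^+ t * ucoord y <= 2^-1.
    have -> : 2^-1 = 2 ^+ t * 2^-1 ^+ t.+1 :> R by rewrite hS mulrCA hK mulr1.
    rewrite ler_pM2l// (le_trans ys)//.
    by rewrite ler_wiXn2l// ltW.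
  move=> y2; rewrite min_r; last lra.
  by rewrite ger0_norm; lra.
have : 1 <= 2 ^+ t * ucoord y.
  by rewrite -[leLHS]hK ler_pM2l// (le_trans _ ey)// ler_wiXn2l// ltW.
move=> y1; rewrite min_l//.
by rewrite ler0_norm; lra.
Qed.

Lemma pol_entropy_double_cap_ge k :
  ((2 * k.+1)%:R%:E <=
   entropy_at_rate (fun n => ln n%:R) (ncomp_map double_cap_cmap k.+1))%E.
Proof.
apply: (@entropy_at_rate_ge _ _ ln_natr_ge0 ln_natr_cvgy _ _ _
  ((2 * k.+1)%:R * ln (2 * k.+1)%:R) 4^-1 (fun l => 2 * k.+1 * l)%N).
- by rewrite invr_gt0.
- by move=> l; rewrite leq_pmull.
- move=> l l0; apply: le_trans (lne_sep_ge _ (sep_double_cap_ge k l)); last first.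
    by rewrite expn_gt0 l0.
  rewrite lee_fin natrX lnXn ?ltr0n// -[leRHS]mulr_natl -mulrBr.
  by rewrite [(_ * l)%:R]natrM lnM ?posrE ?ltr0n// addrAC subrr add0r.
Qed.

End doubling_cut_off.

Local Open Scope ereal_scope.

Theorem theorem5 (R : realType) :
  (exists (X : compactMetricType R) (f : continuousType X X),
     connected [set: X] /\
     forall n : nat, (2 <= n)%N ->
       [/\ top_entropy (conn_map f) < top_entropy (ncomp_map f n),
           top_entropy (ncomp_map f n) < top_entropy (ncomp_map f n.+1) &
           top_entropy (ncomp_map f n.+1) < top_entropy (hyper_map f)]) /\
  (exists (X : compactMetricType R) (f : continuousType X X),
     connected [set: X] /\
     forall n : nat, (2 <= n)%N ->
       [/\ pol_entropy (conn_map f) < pol_entropy (ncomp_map f n),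
           pol_entropy (ncomp_map f n) < pol_entropy (ncomp_map f n.+1) &
           pol_entropy (ncomp_map f n.+1) < pol_entropy (hyper_map f)]).
Proof.
split; exists (unit_interval R).
- exists tent_cmap; split; first exact: unit_interval_connected.
  exact: (entropy_chain_lt (@ler0n R) (@top_entropy_tent_lt R)).
- exists double_cap_cmap; split; first exact: unit_interval_connected.
  apply: (entropy_chain_lt (@ln_natr_ge0 R)) => k k0.
  apply: le_lt_trans (pol_entropy_double_cap_le k) _.
  apply: lt_le_trans (pol_entropy_double_cap_ge k).
  by rewrite lte_fin ltr_nat ltn_pmul2l.
Qed.
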